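(* Let $\boldsymbol{X}\sim \mathbb{ELS}(\boldsymbol{\lambda},\boldsymbol{\theta},\boldsymbol{\alpha};F_{b})$ and $\boldsymbol{Y}\sim \mathbb{ELS}(\boldsymbol{\mu},\boldsymbol{\delta},\boldsymbol{\beta};F_{b})$ be random vectors, each with independent components, where $\boldsymbol{\lambda}=\boldsymbol{\mu}=\lambda\boldsymbol{1}_{n}$ and $\boldsymbol{\theta}=\boldsymbol{\delta}=\theta\boldsymbol{1}_{n}$ for scalars $\lambda,\theta>0$. Suppose that either $\boldsymbol{\alpha},\boldsymbol{\beta}\in\mathcal{E}_+$ or $\boldsymbol{\alpha},\boldsymbol{\beta}\in\mathcal{D}_+$. Then $\boldsymbol{\alpha}\succeq^{w}\boldsymbol{\beta}$ implies $X_{n-1:n}\leq_{st}Y_{n-1:n}$.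
   Context: All random variables are nonnegative and absolutely continuous. $F_b$ is a baseline cumulative distribution function. $\boldsymbol{X}=(X_1,\dots,X_n)\sim\mathbb{ELS}(\boldsymbol\lambda,\boldsymbol\theta,\boldsymbol\alpha;F_b)$ (exponentiated location-scale model), with $\boldsymbol\lambda=(\lambda_1,\dots,\lambda_n)$, $\boldsymbol\theta=(\theta_1,\dots,\theta_n)$, $\boldsymbol\alpha=(\alpha_1,\dots,\alpha_n)$ having positive entries, means that $X_i$ has distribution function $F_{X_i}(x)=[F_b((x-\lambda_i)/\theta_i)]^{\alpha_i}$ for $x>\lambda_i$ (and $0$ for $x\le\lambda_i$), $i=1,\dots,n$. $X_{k:n}$ is the $k$th smallest of $X_1,\dots,X_n$, so $X_{n-1:n}$ is the second-largest order statistic. $\boldsymbol 1_n=(1,\dots,1)$. $\mathcal D_+=\{(x_1,\dots,x_n):x_1\ge x_2\ge\cdots\ge x_n>0\}$ and $\mathcal E_+=\{(x_1,\dots,x_n):0<x_1\le x_2\le\cdots\le x_n\}$. For vectors $\boldsymbol x,\boldsymbol y$ with increasing rearrangements $x_{1:n}\le\cdots\le x_{n:n}$ and $y_{1:n}\le\cdots\le y_{n:n}$, $\boldsymbol y\succeq^w\boldsymbol x$ ($\boldsymbol x$ is weakly supermajorized by $\boldsymbol y$) means $\sum_{i=1}^k x_{i:n}\ge\sum_{i=1}^k y_{i:n}$ for all $k=1,\dots,n$. $U\le_{st}V$ means $P(U>x)\le P(V>x)$ for all $x$. *)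

(* Defs.v *)
From HB Require Import structures.
From mathcomp Require Export all_boot all_order all_algebra.
From mathcomp Require Export all_classical all_reals all_analysis.
From mathcomp Require Import measurable_realfun.

Set Implicit Arguments.
Unset Strict Implicit.
Unset Printing Implicit Defensive.

Import Order.TTheory GRing.Theory Num.Theory.

Local Open Scope classical_set_scope.
Local Open Scope ring_scope.

(* The law Q of a nonnegative, absolutely continuous real random variable. *)
Definition nonneg_ac (R : realType) (Q : set (measurableTypeR R) -> \bar R) :=
  Q `]-oo, 0%R[%classic = 0%E /\ Q `<< (@lebesgue_measure R).

Definition baseline_cdf (R : realType) (F : R -> R) :=
  exists2 Q : probability (measurableTypeR R) R,
    nonneg_ac Q & forall x : R, (F x)%:E = Q `]-oo, x]%classic.

(* Mutual independence; the product rule over a subfamily is the case where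
   the remaining B i are the whole line. *)
Definition independent_RVs (d : measure_display) (T : measurableType d)
    (R : realType) (P : probability T R) (n : nat) (X : 'I_n -> {RV P >-> R}) :=
  forall B : 'I_n -> set (measurableTypeR R), (forall i, measurable (B i)) ->
    P [set w | forall i, B i (X i w)] = (\prod_(i < n) P (X i @^-1` B i))%E.

(* The marginal part of X ~ ELS(lambda, theta, alpha; Fb). *)
Definition ELS (d : measure_display) (T : measurableType d)
    (R : realType) (P : probability T R) (n : nat) (X : 'I_n -> {RV P >-> R})
    (lambda theta alpha : n.-tuple R) (Fb : R -> R) :=
  [/\ forall i, 0 < tnth lambda i,
      forall i, 0 < tnth theta i,
      forall i, 0 < tnth alpha i
    & forall (i : 'I_n) (x : R),
        cdf (X i) x =
          (if tnth lambda i < x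
           then Fb ((x - tnth lambda i) / tnth theta i) `^ tnth alpha i
           else 0)%:E].

(* The k-th smallest entry of x, for 1 <= k <= size x. *)
Definition kth_smallest (R : realType) (x : seq R) (k : nat) : R :=
  nth 0 (sort <=%R x) k.-1.

Definition order_stat (d : measure_display) (T : measurableType d)
    (R : realType) (P : probability T R) (n : nat) (X : 'I_n -> {RV P >-> R})
    (k : nat) : T -> R :=
  fun w => kth_smallest [seq X i w | i <- enum 'I_n] k.

Lemma kth_smallest_gt (R : realType) (x : seq R) (k : nat) (a : R) :
  (k.-1 < size x)%N ->
  (a < kth_smallest x k) = (count (<= a) x <= k.-1)%N.
Proof.
move=> kx; have ss := sort_sorted le_total x.
have sz : size (sort <=%R x) = size x by rewrite size_sort.
have ct : count (<= a) (sort <=%R x) = count (<= a) x.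
  by apply/permP; rewrite perm_sort.
rewrite /kth_smallest; apply/idP/idP => [|h]; last first.
  by apply: nth_count_gt => //; rewrite ct sz h.
apply: contraLR; rewrite -ltnNge -leNgt => h.
by apply: nth_count_le => //; rewrite ct.
Qed.

Lemma measurable_order_stat (d : measure_display) (T : measurableType d)
    (R : realType) (P : probability T R) (n : nat) (X : 'I_n -> {RV P >-> R})
    (k : nat) : measurable_fun setT (order_stat X k).
Proof.
have [kn|nk] := ltnP k.-1 n; last first.
  rewrite (_ : order_stat X k = cst 0); first exact: measurable_cst.
  apply/funext => w; rewrite /order_stat /kth_smallest nth_default//.
  by rewrite size_sort size_map size_enum_ord.
apply: (measurability _ (RGenOInfty.measurableE R)) => //.
move=> _ [_ [a ->] <-]; rewrite setTI.
pose M a (w : T) : R := \sum_(i <- enum 'I_n) \1_(X i @^-1` `]-oo, a]) w.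
have mM : measurable_fun setT (M a).
  apply: measurable_sum => i; apply: measurable_indic.
  by rewrite -[X in measurable X]setTI; apply: measurable_funP.
rewrite [X in measurable X](_ : _ = M a @^-1` `]-oo, k.-1%:R]); last first.
  apply/seteqP; suff E w : (a < order_stat X k w) = (M a w <= k.-1%:R).
    by split=> w /=; rewrite !in_itv/= ?andbT E.
  rewrite /order_stat kth_smallest_gt; last by rewrite size_map size_enum_ord.
  rewrite count_map -sum1_count big_mkcond/= -(ler_nat R) natr_sum.
  congr (_ <= _); apply: eq_bigr => i _.
  rewrite indicE; have -> : (w \in X i @^-1` `]-oo, a]) = (X i w <= a).
    by apply/idP/idP; rewrite inE/= in_itv.
  by rewrite /=; case: (_ <= _).
by rewrite -[X in measurable X]setTI; apply: mM.
Qed.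

HB.instance Definition _ (d : measure_display) (T : measurableType d)
    (R : realType) (P : probability T R) (n : nat) (X : 'I_n -> {RV P >-> R})
    (k : nat) :=
  @isMeasurableFun.Build _ _ T R (order_stat X k) (measurable_order_stat X k).

Definition order_statistic (d : measure_display) (T : measurableType d)
    (R : realType) (P : probability T R) (n : nat) (X : 'I_n -> {RV P >-> R})
    (k : nat) : {RV P >-> R} := order_stat X k.

Definition st_le (d d' : measure_display) (T : measurableType d)
    (T' : measurableType d') (R : realType) (P : probability T R)
    (P' : probability T' R) (U : {RV P >-> R}) (V : {RV P' >-> R}) :=
  forall x : R, (ccdf U x <= ccdf V x)%E.

Definition E_plus (R : realType) (n : nat) (x : n.-tuple R) :=
  (forall i j : 'I_n, (i <= j)%N -> tnth x i <= tnth x j)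
  /\ (forall i, 0 < tnth x i).

Definition D_plus (R : realType) (n : nat) (x : n.-tuple R) :=
  (forall i j : 'I_n, (i <= j)%N -> tnth x j <= tnth x i)
  /\ (forall i, 0 < tnth x i).

(* weak_supermaj y x: x is weakly supermajorized by y. *)
Definition weak_supermaj (R : realType) (n : nat) (y x : n.-tuple R) :=
  forall k : nat, (1 <= k <= n)%N ->
    \sum_(1 <= i < k.+1) kth_smallest y i <= \sum_(1 <= i < k.+1) kth_smallest x i.

(* Main.v *)
Require Import Defs.
From mathcomp Require Import zify ring lra.

(** The second largest of n variables is at most x exactly when at most one of
    them exceeds x.  The events splitting this according to which variable (if
    any) exceeds x are disjoint, so independence turns the distribution function
    into an explicit symmetric polynomial in the marginal values p i
    ([cdf_second_largest]).

    In the common location-scale case p i = u ^ alpha_i with the same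
    u = Fb ((x - l) / t) for every i.  If x <= l or u = 0 both sides have the
    same distribution function at x.  Otherwise put c = - ln u >= 0 and
    a i = c * alpha_i; the polynomial becomes
      exp (- sum a) * (1 + sum (exp (a i) - 1)),
    called [at_most_one_prob] below ([at_most_one_probE]).  It remains to see
    that this function increases when the vector a is replaced by one that
    weakly supermajorizes it ([at_most_one_prob_le]).  For equal totals only the
    sum of the exp (a i) varies, and the claim is Karamata's inequality for the
    convex function exp ([sum_expR_le]), which follows from the tangent lines at
    the smaller vector and a summation by parts.  If the total of a is smaller
    by r, raising the largest entry by r restores equality of the totals
    without changing the shorter partial sums; since exp of that entry is at
    most 1 + sum (exp (a i) - 1), this raise multiplies the second factor by at
    most exp r, which is what the first factor loses.

    Since the sums involved are symmetric, the increasing rearrangements that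
    define weak supermajorization can be substituted for the vectors
    themselves ([sum_sort_tuple]). *)

Set Implicit Arguments.
Unset Strict Implicit.
Unset Printing Implicit Defensive.

Import Order.TTheory GRing.Theory Num.Theory.

Local Open Scope ring_scope.

(** Summation by parts: replacing each weight by the last, largest one only
    adds nonnegative multiples of the nonpositive partial sums. *)
Lemma abel_sum_ge (R : realDomainType) (w e : nat -> R) (n : nat) :
  (forall i, (i < n)%N -> w i <= w i.+1) ->
  (forall k, (k <= n)%N -> \sum_(i < k) e i <= 0) ->
  w n * \sum_(i < n.+1) e i <= \sum_(i < n.+1) w i * e i.
Proof.
elim: n => [|n IHn] ndw e0; first by rewrite !big_ord1.
rewrite big_ord_recr [leRHS]big_ord_recr/= mulrDr lerD2r.
apply: le_trans (IHn _ _) => [|i ilt|k kle].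
- by apply: ler_wnM2r; [exact: e0|exact: ndw].
- by apply: ndw; apply: ltnW.
- by apply: e0; apply: leqW.
Qed.

(** Karamata's inequality for exp.  Tangent lines are taken at [b], so the
    weights in the summation by parts are the slopes exp (b i); this is where
    the monotonicity of [b] enters. *)
Lemma sum_expR_le (R : realType) (a b : nat -> R) (n : nat) :
  (forall i, (i < n)%N -> b i <= b i.+1) ->
  (forall k, (k <= n)%N -> \sum_(i < k) a i <= \sum_(i < k) b i) ->
  \sum_(i < n.+1) a i = \sum_(i < n.+1) b i ->
  \sum_(i < n.+1) expR (b i) <= \sum_(i < n.+1) expR (a i).
Proof.
move=> ndb leab eqab.
have abel : 0 <= \sum_(i < n.+1) expR (b i) * (a i - b i).
  have eq0 : \sum_(i < n.+1) (a i - b i) = 0 by rewrite sumrB eqab subrr.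
  have := @abel_sum_ge R (fun i => expR (b i)) (fun i => a i - b i) n.
  rewrite eq0 mulr0; apply.
    by move=> i ilt; rewrite ler_expR; exact: ndb.
  by move=> k kle; rewrite sumrB subr_le0; exact: leab.
rewrite -subr_ge0 -sumrB; apply: le_trans abel _; apply: ler_sum => i _.
(* tangent line at [b i], through 1 + y <= exp y at y = a i - b i *)
have -> : expR (a i) = expR (b i) * expR (a i - b i).
  by rewrite -expRD addrC subrK.
rewrite -{3}(mulr1 (expR (b i))) -mulrBr.
by apply: ler_wpM2l; [exact: expR_ge0|rewrite lerBrDl expR_ge1Dx].
Qed.

(** The probability that at most one of n independent events occurs, when the
    i-th has probability 1 - exp (- a i): the term 1 accounts for no event and
    the i-th summand for the i-th event alone.  Indexing by [nat] lets partial
    sums be compared without casts between ordinals. *)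
Definition at_most_one_prob (R : realType) (n : nat) (a : nat -> R) : R :=
  expR (- \sum_(i < n) a i) * (1 + \sum_(i < n) (expR (a i) - 1)).

(** Weak supermajorization is reduced to equal totals by raising the last entry
    of [a].  Nonnegativity of [a] is what bounds exp (a n) by the whole factor
    1 + sum (exp (a i) - 1). *)
Lemma at_most_one_prob_le (R : realType) (a b : nat -> R) (n : nat) :
  (forall i, (i <= n)%N -> 0 <= a i) ->
  (forall i, (i < n)%N -> b i <= b i.+1) ->
  (forall k, (k <= n.+1)%N -> \sum_(i < k) a i <= \sum_(i < k) b i) ->
  at_most_one_prob n.+1 b <= at_most_one_prob n.+1 a.
Proof.
move=> a0 ndb leab; rewrite /at_most_one_prob.
set Sa := \sum_(i < n.+1) a i; set Sb := \sum_(i < n.+1) b i.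
pose r := Sb - Sa.
have r0 : 0 <= r by rewrite subr_ge0; exact: leab.
pose a' i := a i + (if i == n then r else 0).
have sum_lt (f g : nat -> R) k : (k <= n)%N ->
    (forall i, i != n -> f i = g i) -> \sum_(i < k) f i = \sum_(i < k) g i.
  move=> kn fg; apply: eq_bigr => i _; apply: fg.
  by rewrite neq_ltn (leq_trans (ltn_ord i) kn).
have a'E i : i != n -> a' i = a i by rewrite /a' => /negbTE ->; rewrite addr0.
have a'n : a' n = a n + r by rewrite /a' eqxx.
have raise : \sum_(i < n.+1) expR (b i) <= \sum_(i < n.+1) expR (a' i).
  apply: sum_expR_le => // [k kn|].
    by rewrite (sum_lt a' a)//; apply: leab; exact: leqW.
  rewrite big_ord_recr/= (sum_lt a' a)// a'n addrA.
  have <- : Sa = \sum_(i < n) a i + a n by rewrite /Sa big_ord_recr.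
  by rewrite addrC subrK.
have sumB (f : nat -> R) :
    \sum_(i < n.+1) (expR (f i) - 1) = \sum_(i < n.+1) expR (f i) - n.+1%:R.
  by rewrite sumrB sumr_const card_ord.
(* the other summands are nonnegative *)
have top : expR (a n) <= 1 + \sum_(i < n.+1) (expR (a i) - 1).
  rewrite big_ord_recr/= addrCA [1 + _]addrC subrK lerDr.
  apply: sumr_ge0 => i _; rewrite subr_ge0 -expR0 ler_expR.
  by apply: a0; exact: ltnW.
have -> : - Sa = - Sb + r by rewrite /r; ring.
rewrite expRD -mulrA; apply: ler_wpM2l; first exact: expR_ge0.
apply: (@le_trans _ _ (1 + \sum_(i < n.+1) (expR (a' i) - 1))).
  by rewrite !sumB lerD2l lerD2r.
have -> : \sum_(i < n.+1) (expR (a' i) - 1) =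
    \sum_(i < n.+1) (expR (a i) - 1) + expR (a n) * (expR r - 1).
  rewrite !sumB big_ord_recr [in RHS]big_ord_recr/=.
  rewrite (sum_lt (fun i => expR (a' i)) (fun i => expR (a i)))//; last first.
    by move=> i /a'E ->.
  by rewrite a'n expRD; ring.
have : 1 <= expR r by rewrite -expR0 ler_expR.
move: top; set Q := 1 + _ => top r1.
(* (Q - exp (a n)) (exp r - 1) >= 0 says Q + exp (a n) (exp r - 1) <= Q exp r *)
rewrite addrA -/Q; have : 0 <= (Q - expR (a n)) * (expR r - 1).
  by rewrite mulr_ge0 ?subr_ge0.
nra.
Qed.

(** The exceptional index [k] is a natural number, not an ordinal: [k = n],
    which no [j : 'I_n] attains, encodes that there is no exception, so that the
    n + 1 cases form a single family. *)
Lemma count_ge_predn (n : nat) (p : pred 'I_n) : (1 < n)%N ->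
  (n.-1.-1 < count p (enum 'I_n))%N <->
  exists2 k : nat, (k < n.+1)%N & forall j : 'I_n, p j = (nat_of_ord j != k).
Proof.
move=> n1.
have -> : count p (enum 'I_n) = #|p| by rewrite cardE -size_filter enumT.
have cC : (#|p| + #|predC p| = n)%N by rewrite -[RHS]card_ord -(cardC p).
have -> : (n.-1.-1 < #|p|)%N = (#|predC p| <= 1)%N.
  move: cC; move: #|p| #|predC p| => u v cC.
  by apply/idP/idP; lia.
split=> [/card_le1_eqP le1|[k _ pk]]; last first.
  apply/card_le1_eqP => i j; rewrite !inE !pk !negbK => /eqP ik /eqP jk.
  by apply: val_inj; rewrite /= ik.
have [k /= pk|pT] := pickP (predC p).
  exists k => [|j]; first by rewrite ltnS ltnW.
  apply/idP/idP => [pj|]; first by apply: contraNneq pk => /val_inj <-.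
  by apply: contraNT => pj; apply/eqP; congr val; exact: le1.
exists n => // j; rewrite neq_ltn ltn_ord.
by have := pT j => /= /negbFE.
Qed.

(** The product is the case where no variable exceeds [x], and the k-th summand
    the case where only [X k] does. *)
Lemma cdf_second_largest (d : measure_display) (T : measurableType d)
    (R : realType) (P : probability T R) (n : nat) (X : 'I_n -> {RV P >-> R})
    (p : 'I_n -> R) (x : R) : (1 < n)%N -> independent_RVs X ->
  (forall i, cdf (X i) x = (p i)%:E) ->
  cdf (order_statistic X n.-1) x =
    (\prod_(i < n) p i + \sum_(k < n) \prod_(i < n)
       (if i == k then 1 - p i else p i))%:E.
Proof.
move=> n1 indX pE.
pose B (k : nat) (j : 'I_n) : set (measurableTypeR R) :=
  (if nat_of_ord j == k then `]x, +oo[ else `]-oo, x])%classic.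
pose F (k : nat) : set T := [set w | forall j, B k j (X j w)]%classic.
have BE k j w : B k j (X j w) <-> (X j w <= x) = (nat_of_ord j != k).
  rewrite /B; case: (_ == k); rewrite /= in_itv/= ?andbT.
    by rewrite ltNge; split => [/negbTE|->].
  by split.
have mB k j : measurable (B k j).
  by rewrite /B; case: ifP => _; exact: measurable_itv.
have mF k : measurable (F k).
  rewrite (_ : F k = \bigcap_(j in [set: 'I_n]) (X j @^-1` B k j))%classic.
    apply: fin_bigcap_measurable => // j _.
    have := @measurable_funP _ _ _ _ setT (X j) measurableT _ (mB k j).
    by rewrite setTI.
  by apply/seteqP; split=> w /= h j; [move=> _; exact: h|exact: h].
have evE : (order_statistic X n.-1 @^-1` `]-oo, x] =
    \bigcup_(k in `I_n.+1) F k)%classic.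
  apply/seteqP; suff evE w : order_stat X n.-1 w <= x <->
      exists2 k, (k < n.+1)%N & F k w.
    by split=> w /=; rewrite in_itv/=; [move/evE|move=> h; apply/evE].
  rewrite leNgt kth_smallest_gt; last by rewrite size_map size_enum_ord; lia.
  rewrite -ltnNge count_map.
  apply: (iff_trans (count_ge_predn _ n1)); split=> -[k kn h]; exists k => // j.
    by apply/BE; have := h j.
  by have /BE := h j.
have PF k : P (F k) =
    (\prod_(i < n) (if nat_of_ord i == k then 1 - p i else p i))%:E.
  rewrite (indX _ (mB k)) -prodEFin; apply: eq_bigr => i _.
  rewrite /B; case: (_ == k); last exact: pE.
  have := ccdf_1_cdf (X i) x; rewrite pE; exact.
rewrite [LHS](_ : _ = P (\bigcup_(k in `I_n.+1) F k)%classic); last first.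
  by rewrite -evE.
rewrite measure_fin_bigcup//; last first.
  move=> i j /= ilt jlt [w [Fi Fj]].
  (* [F k] with [k < n] names the one variable above [x], so it meets no
     other [F l]; hence the asymmetric treatment of the index [n] *)
  have sep k l : (k < n)%N -> F k w -> F l w -> k = l.
    move=> kn Fk Fl.
    have /BE := Fk (Ordinal kn); have /BE := Fl (Ordinal kn).
    by move=> ->/=; rewrite eqxx => /negbFE/eqP.
  have [iltn|nlei] := ltnP i n; first exact: sep.
  have [jltn|nlej] := ltnP j n; first by apply/esym/sep.
  apply/eqP; rewrite eqn_leq -ltnS (leq_trans ilt)// -ltnS.
  by rewrite (leq_trans jlt).
rewrite -fsbig_ord (eq_bigr _ (fun (i : 'I_n.+1) _ => PF i)) sumEFin.
rewrite big_ord_recr/= addrC; congr (_ + _)%:E.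
by apply: eq_bigr => i _; rewrite ltn_eqF.
Qed.

(** Dividing the k-th product by the product of all exp (- a i) leaves
    (1 - exp (- a k)) / exp (- a k) = exp (a k) - 1. *)
Lemma at_most_one_probE (R : realType) (n : nat) (a : nat -> R) :
  at_most_one_prob n a =
  \prod_(i < n) expR (- a i) + \sum_(k < n) \prod_(i < n)
    (if i == k then 1 - expR (- a i) else expR (- a i)).
Proof.
rewrite /at_most_one_prob -sumrN expR_sum mulrDr mulr1 mulr_sumr; congr (_ + _).
apply: eq_bigr => k _; rewrite (bigD1 k)//= [RHS](bigD1 k)//= eqxx.
rewrite [in RHS](eq_bigr (fun i : 'I_n => expR (- a i))); last first.
  by move=> i /negbTE ->.
rewrite mulrAC; congr (_ * _).
by rewrite mulrBr mulr1 -expRD addNr expR0.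
Qed.

Lemma sum_sort_tuple (R : realType) (n : nat) (s : n.-tuple R) (f : R -> R) :
  \sum_(i < n) f (nth 0 (sort <=%R s) i) = \sum_(i < n) f (tnth s i).
Proof.
rewrite -(big_tuple _ _ s xpredT f).
rewrite -(perm_big _ (permEl (perm_sort <=%R s)))/=.
by rewrite (big_nth 0) size_sort size_tuple big_mkord.
Qed.

Lemma at_most_one_prob_sort (R : realType) (n : nat) (s : n.-tuple R) (c : R) :
  at_most_one_prob n (fun i => c * nth 0 (sort <=%R s) i) =
  \prod_(i < n) expR (- (c * tnth s i)) + \sum_(k < n) \prod_(i < n)
    (if i == k then 1 - expR (- (c * tnth s i)) else expR (- (c * tnth s i))).
Proof.
pose a i := c * nth 0 s i.
have aE (i : 'I_n) : c * tnth s i = a i by rewrite (tnth_nth 0).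
under eq_bigr do rewrite aE.
under [X in _ = _ + X]eq_bigr => k _ do under eq_bigr do rewrite aE.
rewrite -at_most_one_probE /at_most_one_prob.
rewrite (sum_sort_tuple s (fun x => c * x)).
rewrite (sum_sort_tuple s (fun x => expR (c * x) - 1)).
by under eq_bigr do rewrite aE; under [X in 1 + X]eq_bigr do rewrite aE.
Qed.

Lemma at_most_one_prob_weak_supermaj (R : realType) (n : nat)
    (alpha beta : n.-tuple R) (c : R) : 0 <= c ->
  (forall i, 0 <= tnth alpha i) -> weak_supermaj alpha beta ->
  at_most_one_prob n (fun i => c * nth 0 (sort <=%R beta) i) <=
  at_most_one_prob n (fun i => c * nth 0 (sort <=%R alpha) i).
Proof.
case: n alpha beta => [|n] alpha beta c0 alpha0 maj.
  by rewrite /at_most_one_prob !big_ord0.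
apply: at_most_one_prob_le => [i ilt|i ilt|[|k] kn].
- rewrite mulr_ge0//.
  have : nth 0 (sort <=%R alpha) i \in (alpha : seq R).
    by rewrite -(mem_sort <=%R) mem_nth// size_sort size_tuple ltnS.
  by move=> /tnthP[j ->].
- apply: ler_wpM2l => //; apply: (sorted_leq_nth le_trans le_refl).
  + exact: sort_sorted le_total _.
  + by rewrite inE size_sort size_tuple ltnW.
  + by rewrite inE size_sort size_tuple.
  + exact: leqnSn.
- by rewrite !big_ord0.
have := maj k.+1 kn; rewrite !big_add1/= !big_mkord => le_sum.
by rewrite -!mulr_sumr ler_wpM2l.
Qed.

Lemma baseline_cdf_itv (R : realType) (F : R -> R) (x : R) :
  baseline_cdf F -> 0 <= F x <= 1.
Proof.
by case=> Q _ FE; rewrite -!lee_fin FE measure_ge0 probability_le1.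
Qed.

(** The exponents being positive, whether the marginal vanishes at [x] depends
    neither on the index nor on [alpha], so all variables of two such models are
    in the same case; [at_most_one_prob] uses the exponential form. *)
Lemma cdf_ELS_common (d : measure_display) (T : measurableType d)
    (R : realType) (P : probability T R) (n : nat) (X : 'I_n -> {RV P >-> R})
    (alpha : n.-tuple R) (Fb : R -> R) (l t x : R) : baseline_cdf Fb ->
  ELS X (nseq_tuple n l) (nseq_tuple n t) alpha Fb ->
  forall i, cdf (X i) x =
    (if (l < x) && (0 < Fb ((x - l) / t))
     then expR (- (- ln (Fb ((x - l) / t)) * tnth alpha i)) else 0)%:E.
Proof.
move=> bFb [_ _ alpha0 cdfX] i.
have tE y : tnth (nseq_tuple n y) i = y :> R.
  by rewrite (tnth_nth 0) nth_nseq ltn_ord.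
rewrite cdfX !tE; case: ifP => //= _; congr EFin.
have /andP[Fb0 _] := baseline_cdf_itv ((x - l) / t) bFb.
rewrite /powR (lt_neqAle 0) Fb0 andbT [0 == _]eq_sym.
by case: eqVneq => /= _; [rewrite gt_eqF|rewrite mulNr opprK mulrC].
Qed.

Theorem theorem3p3 (R : realType) (n : nat) (hn : (2 <= n)%N)
    (d d' : measure_display) (T : measurableType d) (T' : measurableType d')
    (P : probability T R) (P' : probability T' R)
    (X : 'I_n -> {RV P >-> R}) (Y : 'I_n -> {RV P' >-> R})
    (Fb : R -> R)
    (lambda theta alpha mu delta beta : n.-tuple R) (l t : R)
    (hFb : baseline_cdf Fb)
    (hX_ac : forall i, nonneg_ac (distribution P (X i)))
    (hY_ac : forall i, nonneg_ac (distribution P' (Y i)))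
    (hX : ELS X lambda theta alpha Fb) (hX_indep : independent_RVs X)
    (hY : ELS Y mu delta beta Fb) (hY_indep : independent_RVs Y)
    (hl : 0 < l) (ht : 0 < t)
    (hlambda : lambda = nseq_tuple n l) (hmu : mu = nseq_tuple n l)
    (htheta : theta = nseq_tuple n t) (hdelta : delta = nseq_tuple n t)
    (hab : (E_plus alpha /\ E_plus beta) \/ (D_plus alpha /\ D_plus beta)) :
  weak_supermaj alpha beta ->
  st_le (order_statistic X n.-1) (order_statistic Y n.-1).
Proof.
move=> maj x; subst lambda mu theta delta.
have alpha0 i : 0 <= tnth alpha i by case: hX => _ _ alpha0 _; exact: ltW.
rewrite !ccdf_1_cdf; apply: leeB => //.
have := cdf_ELS_common x hFb hX; have := cdf_ELS_common x hFb hY.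
case: (boolP ((l < x) && _)) => [/andP[_ Fx0]|_] cdfY cdfX; last first.
  rewrite (cdf_second_largest hn hX_indep cdfX).
  by rewrite (cdf_second_largest hn hY_indep cdfY).
have /andP[_ Fx1] := baseline_cdf_itv ((x - l) / t) hFb.
set c := - ln _ in cdfX cdfY.
have c0 : 0 <= c by rewrite oppr_ge0 ln_le0.
pose p (s : n.-tuple R) i := expR (- (c * tnth s i)).
rewrite (cdf_second_largest (p := p alpha) hn hX_indep cdfX).
rewrite (cdf_second_largest (p := p beta) hn hY_indep cdfY).
rewrite lee_fin -!at_most_one_prob_sort.
exact: at_most_one_prob_weak_supermaj.
Qed.
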